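(* Let $F:\mathbb{S}^n\to\mathbb{R}^{+}$ be a smooth positive function with $A_F=D^2F+F\,1>0$ at every point of $\mathbb{S}^n$. Let $x:\Sigma\to\mathbb{R}^{n+1}$ be a smooth immersed oriented hypersurface with Gauss map $\nu:\Sigma\to\mathbb{S}^n$, and let $p:=\langle x,\nu\rangle$ be its support function. Then the following identities hold on $\Sigma$: $$\Delta_F(F\circ\nu)+\operatorname{tr}(A_FS^2)\,(F\circ\nu)+\langle\nabla H_F,\,DF|_{\nu}\rangle=\operatorname{tr}(S_F^2),$$ $$\Delta_F\nu+\operatorname{tr}(A_FS^2)\,\nu+\nabla H_F=0,$$ $$\Delta_F p+\operatorname{tr}(A_FS^2)\,p+H_F+\langle x,\nabla H_F\rangle=0.$$
   Context: For a smooth $F:\mathbb{S}^n\to\mathbb{R}^{+}$ on the unit sphere $\mathbb{S}^n\subset\mathbb{R}^{n+1}$, $DF$ and $D^2F$ denote its gradient and Hessian on $\mathbb{S}^n$ with the round metric, and $1$ is the identity on $T_y\mathbb{S}^n$. $A_F:=D^2F+F\,1$ is viewed as a symmetric endomorphism of $T_y\mathbb{S}^n$ at each $y$; ''$>0$'' means positive definite. For the hypersurface $x:\Sigma\to\mathbb{R}^{n+1}$ with its induced metric, $T_q\Sigma$ is identified (via $dx$) with $T_{\nu(q)}\mathbb{S}^n=\nu(q)^\perp$, so $A_F$ evaluated at $\nu(q)$ acts on $T_q\Sigma$ and $DF|_\nu$ (the gradient of $F$ at $\nu(q)$) is a tangent vector field on $\Sigma$. $S:=-d\nu$ is the Weingarten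 operator, with components $h_{ij}$ in a local orthonormal frame. $S_F:=A_F|_\nu\circ S=-A_F|_\nu\circ d\nu$ is the anisotropic Weingarten operator (with components $s_{ij}=\sum_l (A_{il}\circ\nu)h_{lj}$), and $H_F:=\operatorname{tr}S_F$ is the anisotropic mean curvature. $\operatorname{tr}(S_F^2)=\sum_{i,j}s_{ij}s_{ji}$ and $\operatorname{tr}(A_FS^2)=\sum_{i,j,k}(A_{ik}\circ\nu)h_{kj}h_{ji}$. For a smooth function $f$ on $\Sigma$, $\nabla f$ is its gradient in the induced metric and $\Delta_Ff:=\operatorname{div}(A_F|_\nu\nabla f)$, where $\operatorname{div}$ is the divergence on $\Sigma$. For $\mathbb{R}^{n+1}$-valued functions such as $\nu$, $\Delta_F$ is applied componentwise, and tangent vectors of $\Sigma$ such as $\nabla H_F$ are regarded as vectors in $\mathbb{R}^{n+1}$ via $dx$. *)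

(* Defs.v *)
From HB Require Import structures.
From mathcomp Require Import all_boot all_order all_algebra.
From mathcomp Require Import boolp classical_sets reals topology normedtype.
From mathcomp Require Import derive.

Set Implicit Arguments.
Unset Strict Implicit.
Unset Printing Implicit Defensive.

Import Order.TTheory GRing.Theory Num.Theory.
Import numFieldNormedType.Exports.

Local Open Scope classical_set_scope.
Local Open Scope ring_scope.

(* The norm that the library puts on 'rV[R]_m is the sup norm; Euclidean
   lengths are always expressed with this inner product. *)
Definition dotv (R : realType) (m : nat) (u v : 'rV[R]_m) : R :=
  \sum_(i < m) u 0 i * v 0 i.

(* [U] is meant to be open.  In finite dimension, asking that every directional
   derivative be C^k is asking that the differential be C^k. *)
Fixpoint Ck (R : realType) (V W : normedModType R) (k : nat) (U : set V)
    (f : V -> W) : Prop :=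
  if k is k'.+1 then
    (forall a, U a -> differentiable f a) /\ (forall v, Ck k' U ('D_v f))
  else forall a, U a -> {for a, continuous f}.

Definition smooth_on (R : realType) (V W : normedModType R) (U : set V)
    (f : V -> W) : Prop := forall k, Ck k U f.

(* A function on the unit sphere of R^m is given by a function on R^m of which
   only the values on [sphere] are ever used. *)

Section Sphere.
Variables (R : realType) (m : nat).
Implicit Types (F : 'rV[R]_m -> R) (y v : 'rV[R]_m).

Definition sphere : set 'rV[R]_m := [set y | dotv y y = 1].

Definition smooth_on_sphere F : Prop :=
  forall y, sphere y -> exists (U : set 'rV[R]_m) (G : 'rV[R]_m -> R),
    [/\ open U, U y, smooth_on U G & forall z, U z -> sphere z -> G z = F z].

Definition normalize y : 'rV[R]_m := (Num.sqrt (dotv y y))^-1 *: y.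

Definition tangent_part y v : 'rV[R]_m := v - dotv v y *: y.

(* For [y] on the sphere and [v] orthogonal to [y], this is dG_y(v): the
   derivative at t = 0 of G along the curve t |-> (y + t v) / |y + t v|, which
   lies on the sphere, passes through y and has velocity v there. *)
Definition sphere_diff (W : normedModType R) (G : 'rV[R]_m -> W) y v : W :=
  'D_v (G \o normalize) y.

(* DF(y), the tangent vector with <DF(y), v> = dF_y(v) for v orthogonal to y *)
Definition sphere_grad F y : 'rV[R]_m :=
  \row_j sphere_diff F y (tangent_part y (delta_mx 0 j)).

(* D^2 F (v) is the covariant derivative of DF along v, the Levi-Civita
   connection of the round metric being the tangential part of the derivative
   of R^m. *)
Definition sphere_hess F y v : 'rV[R]_m :=
  tangent_part y (sphere_diff (sphere_grad F) y v).

Definition A_ F y v : 'rV[R]_m := sphere_hess F y v + F y *: v.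

Definition A_posdef F : Prop :=
  forall y v, sphere y -> dotv v y = 0 -> v != 0 -> 0 < dotv (A_ F y v) v.

End Sphere.

Record chart (R : realType) (T : Type) (n : nat) := Chart {
  cdom : set T;
  cmap : T -> 'rV[R]_n;
  cinv : 'rV[R]_n -> T }.

Definition cimg (R : realType) (T : Type) (n : nat) (c : chart R T n) :
  set 'rV[R]_n := cmap c @` cdom c.

Definition chart_homeo (R : realType) (T : topologicalType) (n : nat)
    (c : chart R T n) : Prop :=
  [/\ open (cdom c), open (cimg c),
      forall q, cdom c q -> cinv c (cmap c q) = q,
      forall q, cdom c q -> {for q, continuous (cmap c)}
    & forall u, cimg c u -> {for u, continuous (cinv c)}].

Record smoothManifold (R : realType) (n : nat) := SmoothManifold {
  mcarrier :> topologicalType;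
  atlas : set (chart R mcarrier n);
  mhausdorff : hausdorff_space mcarrier;
  msecond_countable : @second_countable mcarrier;
  atlas_homeo : forall c, atlas c -> chart_homeo c;
  atlas_cover : forall q : mcarrier, exists2 c, atlas c & cdom c q;
  atlas_compat : forall c c', atlas c -> atlas c' ->
    smooth_on (cmap c @` (cdom c `&` cdom c')) (cmap c' \o cinv c) }.

Section Hypersurface.
Variables (R : realType) (n : nat) (M : smoothManifold R n).

Definition smooth_map (W : normedModType R) (f : M -> W) : Prop :=
  forall c, atlas c -> smooth_on (cimg c) (f \o cinv c).

Definition pderiv (c : chart R M n) (W : normedModType R) (i : 'I_n)
    (f : M -> W) (q : M) : W :=
  'D_(delta_mx 0 i) (f \o cinv c) (cmap c q).

Definition jacobian (c : chart R M n) (x : M -> 'rV[R]_n.+1) (q : M) :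
  'M[R]_(n, n.+1) := \matrix_(i, j) pderiv c i x q 0 j.

Definition immersion (x : M -> 'rV[R]_n.+1) : Prop :=
  smooth_map x /\
  forall c q, atlas c -> cdom c q -> row_free (jacobian c x q).

(* The orientation of a hypersurface of R^(n+1) is carried by its Gauss map,
   i.e. by the choice of a smooth unit normal field. *)
Definition gauss_map (x nu : M -> 'rV[R]_n.+1) : Prop :=
  [/\ smooth_map nu, forall q, sphere (nu q)
    & forall c q i, atlas c -> cdom c q -> dotv (pderiv c i x q) (nu q) = 0].

(* Local expressions in a chart [c] around [q].  A tangent vector of M at q is
    represented by its image under dx, a vector of R^(n+1) orthogonal to
    [nu q], and an endomorphism of the tangent space by a function on
    'rV[R]_n.+1 of which only the values on tangent vectors are used. *)

Variable (c : chart R M n) (x : M -> 'rV[R]_n.+1).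

Definition metric (q : M) : 'M[R]_n :=
  \matrix_(i, j) dotv (pderiv c i x q) (pderiv c j x q).

Definition inv_metric (q : M) : 'M[R]_n := invmx (metric q).

(* The i-th component of the tangent vector v in the frame of the d_i x *)
Definition tcoord (q : M) (v : 'rV[R]_n.+1) (i : 'I_n) : R :=
  \sum_(j < n) inv_metric q i j * dotv v (pderiv c j x q).

Definition ttrace (q : M) (L : 'rV[R]_n.+1 -> 'rV[R]_n.+1) : R :=
  \sum_(i < n) tcoord q (L (pderiv c i x q)) i.

Definition gradient (f : M -> R) (q : M) : 'rV[R]_n.+1 :=
  \sum_(i < n) (\sum_(j < n) inv_metric q i j * pderiv c j f q)
                 *: pderiv c i x q.

(* Gamma^k_ij, the Christoffel symbols of the Levi-Civita connection of the
   induced metric *)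
Definition christoffel (k i j : 'I_n) (q : M) : R :=
  2^-1 * \sum_(l < n) inv_metric q k l *
    (pderiv c i (fun q' => metric q' j l) q
     + pderiv c j (fun q' => metric q' i l) q
     - pderiv c l (fun q' => metric q' i j) q).

(* The trace of the covariant derivative of the tangent field X *)
Definition divergence (X : M -> 'rV[R]_n.+1) (q : M) : R :=
  \sum_(i < n) (pderiv c i (fun q' => tcoord q' (X q') i) q
                + \sum_(j < n) christoffel i i j q * tcoord q (X q) j).

Variables (F : 'rV[R]_n.+1 -> R) (nu : M -> 'rV[R]_n.+1).

(* S = - d nu, with d nu evaluated on the tangent vector v = sum_i v^i d_i x *)
Definition weingarten (q : M) (v : 'rV[R]_n.+1) : 'rV[R]_n.+1 :=
  - \sum_(i < n) tcoord q v i *: pderiv c i nu q.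

Definition aweingarten (q : M) (v : 'rV[R]_n.+1) : 'rV[R]_n.+1 :=
  A_ F (nu q) (weingarten q v).

Definition amean_curv (q : M) : R := ttrace q (aweingarten q).

Definition tr_SF2 (q : M) : R := ttrace q (aweingarten q \o aweingarten q).

Definition tr_AS2 (q : M) : R :=
  ttrace q (A_ F (nu q) \o weingarten q \o weingarten q).

Definition alaplacian (f : M -> R) (q : M) : R :=
  divergence (fun q' => A_ F (nu q') (gradient f q')) q.

Definition alaplacian_vec (X : M -> 'rV[R]_n.+1) (q : M) : 'rV[R]_n.+1 :=
  \row_j alaplacian (fun q' => X q' 0 j) q.

End Hypersurface.

(* Main.v *)
Require Import Defs.
From HB Require Import structures.
From mathcomp Require Import all_boot all_order all_algebra.
From mathcomp Require Import boolp classical_sets functions reals.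
From mathcomp Require Import interval_inference topology normedtype.
From mathcomp Require Import landau derive realfun.
From mathcomp Require Import ring.

Set Implicit Arguments.
Unset Strict Implicit.
Unset Printing Implicit Defensive.

Import Order.TTheory GRing.Theory Num.Theory.
Import numFieldNormedType.Exports.

Local Open Scope classical_set_scope.
Local Open Scope ring_scope.

(** Let nu_i be the derivative of nu along the i-th coordinate of the chart, E^i
    the frame dual to the coordinate frame d_i x, and

      xi = DF(nu) + F(nu) nu

    the Cahn-Hoffman map.  Since DF(nu) is orthogonal to nu, the normal components
    of the derivatives of its two terms cancel, and d xi = A_F o d nu = - S_F; thus
    xi_i = A_F nu_i is tangent, and H_F = - sum_i <xi_i, E^i>.

    The three identities are instances of one divergence formula
    ([divergence_transport]).  For a field C with values in R^(n+1), put
    W_C = sum_i <C, E^i> xi_i, the image under d xi of the tangential part of C.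
    Then

      div W_C = - <C, grad H_F> - tr(A_F S^2) <C, nu>
                + sum_ij <C_i, E^j> <xi_j, E^i>.

    The first term appears because the second derivatives of xi commute, which
    is the Codazzi equation in this setting; the second one comes from the
    normal component of d_i E^j; the Christoffel symbols hidden in the
    tangential component of d_i E^j cancel because they are symmetric.

    If a function f satisfies d_i f = <C, nu_i> for all i then grad f is the
    image under d nu of the tangential part of C, because d nu is self-adjoint
    ([gradient_shape]); applying A_F gives A_F grad f = W_C, and the formula
    computes Delta_F f ([alaplacian_transport]).  The functions F o nu, a
    component of nu, and p = <x, nu> satisfy the hypothesis with C = xi, a
    constant basis vector, and x respectively.  For these three fields the last
    sum of the formula is tr(S_F^2), 0 and - H_F.

    The analytic input is that C^k functions are closed under the usual
    operations, that second derivatives commute ([derive_comm]), and that in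
    tangent directions F o normalize has the same derivative as any local smooth
    extension of F ([sphere_diff_ext]), so that DF is smooth as well. *)

(** * Locality and algebra of C^k functions *)

Section SmoothFunctions.
Variables (R : realType) (V : normedModType R) (U : set V).
Hypothesis U_open : open U.

Lemma near_open (P : V -> Prop) (a : V) :
  U a -> (forall z, U z -> P z) -> \near a, P a.
Proof.
move=> Ua UP; apply: (@filterS _ _ _ U) => //.
exact: open_nbhs_nbhs.
Qed.

Lemma derive_eq_on (W : normedModType R) (f g : V -> W) (a v : V) :
  U a -> (forall z, U z -> f z = g z) -> 'D_v f a = 'D_v g a.
Proof. by move=> Ua fg; apply: near_eq_derive; apply: near_open. Qed.

(** The difference [g - f] vanishes near [a], hence is differentiable there with
    differential 0; then [g = f + (g - f)]. *)
Lemma differentiable_eq_on (W : normedModType R) (f g : V -> W) (a : V) :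
  U a -> (forall z, U z -> f z = g z) ->
  differentiable f a -> differentiable g a.
Proof.
move=> Ua fg df; rewrite (_ : g = f + (g - f)); last first.
  by apply/funext => z; rewrite !fctE addrC subrK.
apply: differentiableD => //; set h := g - f.
have h0 z : U z -> h z = 0 by move=> Uz; rewrite /h !fctE fg// subrr.
have zC : continuous (\0 : V -> W) by move=> z; exact: cst_continuous.
have hE : h \o shift a = cst (h a) + (\0 : {linear V -> W}) +o_ 0 id.
  apply/eqaddoP => _/posnumP[e].
  have : \near a, h a = 0 by apply: near_open.
  rewrite (near_shift 0 a) subr0 /= => nh; near=> z.
  have -> : (h \o shift a - (cst (h a) + \0)) z = 0.
    rewrite !fctE /= (h0 a Ua) !addr0 subr0.
    by near: z.
  by rewrite normr0 mulr_ge0.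
apply/diff_locallyP; rewrite (diff_unique zC hE); split => //.
Unshelve. all: by end_near. Qed.
End SmoothFunctions.

(** The recursion in a form whose components are again instances of [Ck], not of the
    anonymous fixpoint to which [Ck] reduces. *)
Lemma CkS (R : realType) (V W : normedModType R) (U : set V) k (f : V -> W) :
  Ck k.+1 U f <->
  (forall a, U a -> differentiable f a) /\ (forall v, Ck k U ('D_v f)).
Proof. by []. Qed.

Lemma Ck_sub (R : realType) (V W : normedModType R) (A B : set V) k
    (f : V -> W) : (forall z, A z -> B z) -> Ck k B f -> Ck k A f.
Proof.
move=> AB; elim: k f => [|k IH] f; first by move=> cf a Aa; exact/cf/AB.
by move=> /CkS[df Df]; split=> [a Aa|v]; [exact/df/AB|exact: IH].
Qed.

Section CkTheory.
Variables (R : realType) (V : normedModType R) (U : set V).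
Hypothesis U_open : open U.
Implicit Types (f g : V -> R).

Lemma Ck_eq_on (W : normedModType R) k (f g : V -> W) :
  (forall z, U z -> f z = g z) -> Ck k U f -> Ck k U g.
Proof.
elim: k f g => [|k IH] f g fg.
  move=> cf a Ua; have := cf a Ua; rewrite /prop_for /continuous_at (fg a Ua).
  apply: cvg_trans; apply: near_eq_cvg.
  exact: (near_open U_open Ua fg).
move=> /CkS[df Df]; split=> [a Ua|v].
  exact: (differentiable_eq_on U_open Ua fg (df a Ua)).
by apply: IH (Df v) => z Uz; apply: (derive_eq_on U_open).
Qed.

Lemma Ck_pred (W : normedModType R) k (f : V -> W) : Ck k.+1 U f -> Ck k U f.
Proof.
elim: k f => [|k IH] f /CkS[df Df].
  by move=> a Ua; apply: differentiable_continuous (df a Ua).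
by split=> // v; apply: IH.
Qed.

Lemma Ck_local (W : normedModType R) k (f : V -> W) :
  (forall a, U a -> exists B : set V, [/\ B a, open B & Ck k B f]) -> Ck k U f.
Proof.
elim: k f => [|k IH] f loc.
  by move=> a /loc[B [Ba _]]; apply.
split=> [a /loc[B [Ba _ [df _]]]|v]; first exact: df.
by apply: IH => a /loc[B [Ba Bo /CkS[_ Df]]]; exists B; split.
Qed.

Lemma Ck_cst (W : normedModType R) k (w : W) : Ck k U (fun=> w).
Proof.
elim: k w => [|k IH] w /=; first by move=> a _; exact: cst_continuous.
split=> [a _|v]; first exact: differentiable_cst.
rewrite (_ : 'D_v _ = fun=> 0); first exact: IH.
by apply/funext => z; exact: derive_cst.
Qed.

Lemma CkD (W : normedModType R) k (f g : V -> W) :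
  Ck k U f -> Ck k U g -> Ck k U (fun z => f z + g z).
Proof.
elim: k f g => [|k IH] f g.
  by move=> cf cg a Ua; apply: continuousD; [exact: cf|exact: cg].
move=> /CkS[df Df] /CkS[dg Dg]; split=> [a Ua|v].
  by apply: differentiableD; [exact: df|exact: dg].
apply: Ck_eq_on (IH _ _ (Df v) (Dg v)) => z Uz.
by rewrite -deriveD//; apply: diff_derivable; [exact: df|exact: dg].
Qed.

Lemma CkM k f g : Ck k U f -> Ck k U g -> Ck k U (fun z => f z * g z).
Proof.
elim: k f g => [|k IH] f g.
  by move=> cf cg a Ua; apply: continuousM; [exact: cf|exact: cg].
move=> Cf Cg; have /CkS[df Df] := Cf; have /CkS[dg Dg] := Cg; split=> [a Ua|v].
  by apply: differentiableM; [exact: df|exact: dg].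
apply: Ck_eq_on (CkD (IH _ _ (Ck_pred Cf) (Dg v)) (IH _ _ (Ck_pred Cg) (Df v))).
move=> z Uz /=.
by rewrite [RHS]deriveM//; apply: diff_derivable; [exact: df|exact: dg].
Qed.

(** Induction on [k] through (1/f)' = - f'/f^2, whose right-hand side contains 1/f
    only at order [k]. *)
Lemma CkV k f : (forall z, U z -> f z != 0) ->
  Ck k U f -> Ck k U (fun z => (f z)^-1).
Proof.
move=> f0; elim: k f f0 => [|k IH] f f0.
  by move=> cf a Ua; apply: continuousV; [exact: f0|exact: cf].
move=> Cf; have /CkS[df Df] := Cf; split=> [a Ua|v].
  by apply: differentiableV; [exact: df|exact: f0].
have CV := IH _ f0 (Ck_pred Cf).
have CN : Ck k U (fun=> -1 : R) := @Ck_cst R k (-1).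
apply: Ck_eq_on (CkM CN (CkM (CkM CV CV) (Df v))) => z Uz /=.
rewrite [RHS]deriveV//; [|exact: f0|by apply: diff_derivable; exact: df].
by rewrite mulN1r expr2 invfM scaleNr.
Qed.

Lemma Ck_sum (W : normedModType R) k I (r : seq I) (P : pred I) (f : I -> V -> W) :
  (forall i, P i -> Ck k U (f i)) -> Ck k U (fun z => \sum_(i <- r | P i) f i z).
Proof.
move=> Cf; elim: r => [|i r IH].
  by under eq_fun do rewrite big_nil; exact: Ck_cst.
under eq_fun do rewrite big_cons.
by case: (boolP (P i)) => // Pi; apply: CkD => //; exact: Cf.
Qed.

Lemma Ck_prod k I (r : seq I) (P : pred I) (f : I -> V -> R) :
  (forall i, P i -> Ck k U (f i)) -> Ck k U (fun z => \prod_(i <- r | P i) f i z).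
Proof.
move=> Cf; elim: r => [|i r IH].
  by under eq_fun do rewrite big_nil; exact: Ck_cst.
under eq_fun do rewrite big_cons.
by case: (boolP (P i)) => // Pi; apply: CkM => //; exact: Cf.
Qed.

End CkTheory.

(** * Vector-valued C^k functions and composition *)

Section CkVector.
Variables (R : realType) (V : normedModType R) (U : set V).
Hypothesis U_open : open U.

Lemma derive_comp (W W' : normedModType R) (f : W -> W') (g : V -> W) a v :
  differentiable g a -> differentiable f (g a) ->
  'D_v (f \o g) a = 'D_('D_v g a) f (g a).
Proof.
move=> dg df; rewrite !deriveE//; last exact: differentiable_comp.
by rewrite diff_comp.
Qed.

Lemma derive_basis m (W : normedModType R) (f : 'rV[R]_m -> W) a v :
  differentiable f a ->
  'D_v f a = \sum_(j < m) v 0 j *: 'D_(delta_mx 0 j) f a.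
Proof.
move=> df; rewrite deriveE// {1}(row_sum_delta v) linear_sum.
by apply: eq_bigr => j _; rewrite linearZ deriveE.
Qed.

Lemma derive_coord m (g : V -> 'rV[R]_m) a v j :
  differentiable g a -> 'D_v (fun z => g z 0 j) a = 'D_v g a 0 j.
Proof. by move=> dg; rewrite derive_mx ?mxE//; exact: diff_derivable. Qed.

Lemma Ck_scalel (W : normedModType R) k (g : V -> R) (w : W) :
  Ck k U g -> Ck k U (fun z => g z *: w).
Proof.
elim: k g => [|k IH] g.
  by move=> cg a Ua; apply: continuousZl; exact: cg.
move=> /CkS[dg Dg]; split=> [a Ua|v]; first by apply: differentiableZl; exact: dg.
apply: Ck_eq_on (IH _ (Dg v)) => // z Uz.
have dgz := dg _ Uz; rewrite !deriveE//; last exact: differentiableZl.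
by rewrite diffZl.
Qed.

(** Decomposing along the canonical basis reduces the vector case to scalar
    functions multiplied by constant vectors. *)
Lemma Ck_row m k (g : V -> 'rV[R]_m) :
  (forall j, Ck k U (fun z => g z 0 j)) -> Ck k U g.
Proof.
move=> Cg; rewrite (_ : g = fun z => \sum_j g z 0 j *: delta_mx 0 j).
  by apply: Ck_sum => // j _; apply: Ck_scalel.
by apply/funext => z; exact: row_sum_delta.
Qed.

Lemma differentiable_entry m (g : V -> 'rV[R]_m) a j :
  differentiable g a -> differentiable (fun z => g z 0 j) a.
Proof.
move=> dg; apply: (differentiable_comp (g := fun M : 'rV_m => M 0 j) dg).
exact: differentiable_coord.
Qed.

Lemma Ck_coord m k (g : V -> 'rV[R]_m) j :
  Ck k U g -> Ck k U (fun z => g z 0 j).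
Proof.
elim: k g => [|k IH] g.
  move=> cg a Ua; apply: (@continuous_comp _ _ _ g (fun M : 'rV_m => M 0 j)).
    exact: cg.
  exact: coord_continuous.
move=> /CkS[dg Dg]; split=> [a Ua|v]; first exact: differentiable_entry (dg a Ua).
apply: Ck_eq_on (IH _ (Dg v)) => // z Uz.
by rewrite derive_coord//; exact: dg.
Qed.

(** The chain rule expresses a derivative of [f \o g] as a sum of products of
    components of a derivative of [g] with functions ([D_j f] composed with [g])
    to which the induction hypothesis applies. *)
Lemma Ck_comp m k (B : set 'rV[R]_m) (f : 'rV[R]_m -> R) (g : V -> 'rV[R]_m) :
  (forall z, U z -> B (g z)) -> Ck k B f -> Ck k U g -> Ck k U (f \o g).
Proof.
move=> gB; elim: k f => [|k IH] f.
  by move=> cf cg a Ua; apply: continuous_comp; [exact: cg|exact/cf/gB].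
move=> /CkS[df Df] Cg; have /CkS[dg Dg] := Cg; split=> [a Ua|v].
  by apply: differentiable_comp; [exact: dg|exact/df/gB].
have C j : Ck k U (fun z => 'D_v g z 0 j * ('D_(delta_mx 0 j) f \o g) z).
  apply: CkM => //; first by apply: Ck_coord.
  by apply: IH => //; exact: Ck_pred.
have Csum := Ck_sum U_open (index_enum _) (P := predT) (fun j _ => C j).
apply: Ck_eq_on Csum => // z Uz.
have dfz := df _ (gB _ Uz); have dgz := dg _ Uz.
by rewrite [RHS]derive_comp// [RHS]derive_basis.
Qed.

End CkVector.

(** * Symmetry of second derivatives *)

Section Schwarz.
Variables (R : realType) (V : normedModType R).
Implicit Types (f : V -> R).

Lemma is_derive_line f (b v : V) (s : R) :
  differentiable f (b + s *: v) ->
  is_derive s 1 (fun t : R => f (b + t *: v)) ('D_v f (b + s *: v)).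
Proof.
move=> df; have dv := @diff_derivable _ _ _ _ _ v df.
have E : (fun h : R => h^-1 *: (f (b + (h *: 1 + s) *: v) - f (b + s *: v))) =
         (fun h : R => h^-1 *: (f (h *: v + (b + s *: v)) - f (b + s *: v))).
  apply/funext => h; congr (_ *: (f _ - _)).
  by rewrite (_ : h%:A = h) ?scalerDl//; [rewrite addrCA|exact: mulr1].
apply: DeriveDef; first by rewrite /derivable /= E.
by rewrite /derive /= E.
Qed.

(** Two applications of the mean value theorem: first to the difference of the
    restrictions of [f] to two parallel segments of direction [v], then to ['D_v f]
    along a segment of direction [w]. *)
Lemma second_difference f (a v w : V) (t : R) : 0 < t ->
  (forall s r, 0 <= s <= t -> 0 <= r <= t ->
     differentiable f (a + s *: v + r *: w) /\
     differentiable ('D_v f) (a + s *: v + r *: w)) ->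
  exists s r, [/\ 0 <= s <= t, 0 <= r <= t &
    f (a + t *: v + t *: w) - f (a + t *: v) - f (a + t *: w) + f a =
    'D_w ('D_v f) (a + s *: v + r *: w) * t ^+ 2].
Proof.
move=> t0 df; have t00 : 0 <= t <= t by rewrite lexx ltW.
have z00 : (0 : R) <= 0 <= t by rewrite lexx ltW.
pose phi s := f (a + t *: w + s *: v) - f (a + s *: v).
pose phi' s := 'D_v f (a + t *: w + s *: v) - 'D_v f (a + s *: v).
have dphi s : 0 <= s <= t -> is_derive s 1 phi (phi' s).
  move=> st; apply: is_deriveB; apply: is_derive_line.
    by rewrite addrAC; have [] := df s t st t00.
  by have [] := df s 0 st z00; rewrite scale0r addr0.
have cphi : {within `[0, t], continuous phi}.
  apply: derivable_within_continuous => s; rewrite in_itv /= => /dphi D.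
  exact: (@ex_derive _ _ _ _ _ _ _ D).
have oc (s : R) : s \in `]0, t[ -> 0 <= s <= t.
  by rewrite in_itv /= => /andP[/ltW-> /ltW->].
have [s /oc st Ephi] := MVT t0 (fun s st => dphi s (oc s st)) cphi.
pose psi r := 'D_v f (a + s *: v + r *: w).
pose psi' r := 'D_w ('D_v f) (a + s *: v + r *: w).
have dpsi r : 0 <= r <= t -> is_derive r 1 psi (psi' r).
  by move=> rt; apply: is_derive_line; have [] := df s r st rt.
have cpsi : {within `[0, t], continuous psi}.
  apply: derivable_within_continuous => r; rewrite in_itv /= => /dpsi D.
  exact: (@ex_derive _ _ _ _ _ _ _ D).
have [r /oc rt Epsi] := MVT t0 (fun s st => dpsi s (oc s st)) cpsi.
exists s, r; split => //.
transitivity (phi t - phi 0).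
  rewrite /phi !scale0r !addr0 opprB -!addrA; congr (f (a + _) + (_ + _)).
    by rewrite addrC.
  by rewrite addrC.
rewrite Ephi subr0 expr2 mulrA; congr (_ * _).
transitivity (psi t - psi 0); last by rewrite Epsi subr0.
by rewrite /phi' /psi scale0r addr0 addrAC.
Qed.

Lemma continuous2_ball (U : set V) (g h : V -> R) (a : V) (e : R) :
  open U -> U a -> 0 < e ->
  {for a, continuous g} -> {for a, continuous h} ->
  exists2 d, 0 < d & forall z, `|z - a| < d ->
    [/\ U z, `|g a - g z| <= e & `|h a - h z| <= e].
Proof.
move=> U_open Ua e0 cg ch.
have nU : \forall z \near a, U z by exact: open_nbhs_nbhs.
have /cvgrPdist_le/(_ _ e0) ng := cg.
have /cvgrPdist_le/(_ _ e0) nh := ch.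
have Nball : nbhs a (U `&`
    ([set z | `|g a - g z| <= e] `&` [set z | `|h a - h z| <= e])).
  by apply: filterI => //; exact: filterI.
have /nbhs_ballP[d /= d0 Bd] := Nball.
exists d => // z zd.
have [] := Bd z; first by rewrite -ball_normE /= distrC.
by move=> Uz [gz hz]; split.
Qed.

(** The second difference quotient of [f] at [a] is symmetric in [v] and [w], and by
    [second_difference] it is a value, at some point close to [a], of either mixed
    derivative; continuity of both at [a] then forces them to agree. *)
Lemma derive_comm (U : set V) f (a v w : V) : open U -> U a -> smooth_on U f ->
  'D_w ('D_v f) a = 'D_v ('D_w f) a.
Proof.
move=> U_open Ua f_smooth.
have /CkS[df Df] := f_smooth 2.
have /CkS[dv /(_ w) cv] := Df v; have /CkS[dw /(_ v) cw] := Df w.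
set L1 := LHS; set L2 := RHS.
apply/eqP; rewrite -subr_eq0 -normr_le0; apply/ler_addgt0Pr => e e0.
rewrite add0r.
have e20 : 0 < e / 2 by rewrite divr_gt0.
have [d d0 Bd] := continuous2_ball U_open Ua e20 (cv a Ua) (cw a Ua).
(* Chosen so that the parallelogram spanned by t v and t w at a lies in the ball of
   radius d; the summand 1 covers the case v = w = 0. *)
pose t := d / (2 * (`|v| + `|w| + 1)).
have N0 : 0 < `|v| + `|w| + 1 by rewrite ltr_wpDl// addr_ge0.
have t0 : 0 < t by rewrite divr_gt0// mulr_gt0.
have inB s r : 0 <= s <= t -> 0 <= r <= t ->
    [/\ U (a + s *: v + r *: w),
    `|L1 - 'D_w ('D_v f) (a + s *: v + r *: w)| <= e / 2 &
    `|L2 - 'D_v ('D_w f) (a + s *: v + r *: w)| <= e / 2].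
  move=> /andP[s0 st] /andP[r0 rt]; apply: Bd.
  have -> : a + s *: v + r *: w - a = s *: v + r *: w.
    by rewrite addrC !addrA addNr add0r.
  apply: (@le_lt_trans _ _ (t * (`|v| + `|w| + 1))).
    apply: le_trans (ler_normD _ _) _.
    rewrite !normrZ !ger0_norm// !mulrDr -[leLHS]addr0 lerD//; last first.
      by rewrite mulr1 ltW.
    by apply: lerD; apply: ler_wpM2r.
  rewrite /t invfM mulrA mulfVK ?gt_eqF//.
  by rewrite ltr_pdivrMr// mulr_natr mulr2n ltrDr.
have [|s [r [st rt E1]]] := @second_difference f a v w t t0.
  by move=> s r st rt; have [Uz _ _] := inB s r st rt; split; [exact: df|exact: dv].
have [|s' [r' [st' rt' E2]]] := @second_difference f a w v t t0.
  move=> s' r' st' rt'; rewrite addrAC; have [Uz _ _] := inB r' s' rt' st'.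
  by split; [exact: df|exact: dw].
have cancel (p1 p2 p3 p4 l1 l2 k : R) : k != 0 ->
    p1 - p2 - p3 + p4 = l1 * k -> p1 - p3 - p2 + p4 = l2 * k -> l1 = l2.
  by move=> k0 e1 e2; apply: (mulIf k0); rewrite -e1 -e2 [p1 - _ - _]addrAC.
have close (l1 l2 l : R) :
    `|l1 - l| <= e / 2 -> `|l2 - l| <= e / 2 -> `|l1 - l2| <= e.
  move=> h1 h2; apply: le_trans (ler_distD l _ _) _.
  by rewrite [e]splitr lerD// distrC.
have [_ B1 _] := inB s r st rt; have [_ _ B2] := inB r' s' rt' st'.
rewrite [a + t *: w + _]addrAC [a + s' *: w + _]addrAC in E2.
have t20 : t ^+ 2 != 0 by rewrite expf_neq0// gt_eqF.
rewrite (cancel _ _ _ _ _ _ _ t20 E1 E2) in B1.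
exact: close B1 B2.
Qed.

End Schwarz.

(** * The Euclidean inner product *)

Section Dotv.
Variables (R : realType) (m : nat).
Implicit Types (u v w : 'rV[R]_m).

Lemma dotvC u v : dotv u v = dotv v u.
Proof. by apply: eq_bigr => i _; rewrite mulrC. Qed.

Lemma dotvDl u v w : dotv (u + v) w = dotv u w + dotv v w.
Proof. by rewrite -big_split; apply: eq_bigr => i _; rewrite mxE mulrDl. Qed.

Lemma dotvZl a u v : dotv (a *: u) v = a * dotv u v.
Proof. by rewrite mulr_sumr; apply: eq_bigr => i _; rewrite mxE mulrA. Qed.

Lemma dotvNl u v : dotv (- u) v = - dotv u v.
Proof. by rewrite -scaleN1r dotvZl mulN1r. Qed.

Lemma dotvBl u v w : dotv (u - v) w = dotv u w - dotv v w.
Proof. by rewrite dotvDl dotvNl. Qed.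

Lemma dotvZr a u v : dotv u (a *: v) = a * dotv u v.
Proof. by rewrite !(dotvC u) dotvZl. Qed.

Lemma dotv0l u : dotv 0 u = 0.
Proof. by rewrite -(scale0r 0) dotvZl mul0r. Qed.

Lemma dotv_suml I (r : seq I) (P : pred I) (f : I -> 'rV[R]_m) v :
  dotv (\sum_(i <- r | P i) f i) v = \sum_(i <- r | P i) dotv (f i) v.
Proof.
by apply: (big_morph (fun u => dotv u v)) => [u w|]; rewrite ?dotvDl ?dotv0l.
Qed.

Lemma dotv_sumr I (r : seq I) (P : pred I) (f : I -> 'rV[R]_m) v :
  dotv v (\sum_(i <- r | P i) f i) = \sum_(i <- r | P i) dotv v (f i).
Proof. by rewrite dotvC dotv_suml; apply: eq_bigr => i _; rewrite dotvC. Qed.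

Lemma dotv_deltal j v : dotv (delta_mx 0 j) v = v 0 j.
Proof.
rewrite /dotv (bigD1 j)//= mxE !eqxx mul1r big1 ?addr0// => i ij.
by rewrite mxE (negPf ij) andbF mul0r.
Qed.

Lemma dotvv_ge0 v : 0 <= dotv v v.
Proof. by apply: sumr_ge0 => i _; rewrite -expr2 sqr_ge0. Qed.

Lemma normalize_sphere v : dotv v v != 0 -> sphere (normalize v).
Proof.
move=> v0; rewrite /sphere /= /normalize dotvZl dotvZr mulrA -expr2 exprVn.
by rewrite sqr_sqrtr ?dotvv_ge0// mulVf.
Qed.

Lemma normalize_id v : sphere v -> normalize v = v.
Proof. by rewrite /sphere /= /normalize => ->; rewrite sqrtr1 invr1 scale1r. Qed.

End Dotv.

Section DotvCalculus.
Variables (R : realType) (V : normedModType R) (m : nat).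
Implicit Types (f g : V -> 'rV[R]_m).

Lemma differentiable_row g a :
  (forall j, differentiable (fun z => g z 0 j) a) -> differentiable g a.
Proof.
move=> dg; rewrite (_ : g = \sum_j (fun z => g z 0 j *: delta_mx 0 j)).
  by apply: differentiable_sum => j; apply: differentiableZl.
by apply/funext => z; rewrite fct_sumE; exact: row_sum_delta.
Qed.

Lemma differentiable_dotv f g a :
  differentiable f a -> differentiable g a ->
  differentiable (fun z => dotv (f z) (g z)) a.
Proof.
move=> df dg.
rewrite (_ : (fun z => _) = \sum_j (fun z => f z 0 j * g z 0 j)); last first.
  by apply/funext => z; rewrite fct_sumE.
by apply: differentiable_sum => j; apply: differentiableM;
  apply: differentiable_entry.
Qed.

Lemma derive_dotv f g a v :
  differentiable f a -> differentiable g a ->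
  'D_v (fun z => dotv (f z) (g z)) a =
  dotv ('D_v f a) (g a) + dotv (f a) ('D_v g a).
Proof.
move=> df dg.
rewrite (_ : (fun z => _) = \sum_j (fun z => f z 0 j * g z 0 j)); last first.
  by apply/funext => z; rewrite fct_sumE.
have dfj j := differentiable_entry j df.
have dgj j := differentiable_entry j dg.
rewrite derive_sum; last first.
  by move=> j; apply: diff_derivable; exact: differentiableM.
rewrite -big_split; apply: eq_bigr => j _ /=.
rewrite [LHS]deriveM; [|exact: diff_derivable..].
rewrite addrC; congr (_ + _); rewrite derive_coord//; exact: mulrC.
Qed.

End DotvCalculus.

(** * Functions on the unit sphere *)

Section Sphere.
Variables (R : realType) (m : nat).
Implicit Types (F : 'rV[R]_m -> R) (y v : 'rV[R]_m).

Lemma differentiable_inv_sqrt1 : differentiable (fun r : R => (Num.sqrt r)^-1)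
  (1 : R).
Proof.
apply: differentiableV; last by rewrite sqrtr1 oner_neq0.
have D := is_derive1_sqrt (@ltr01 R).
by apply/derivable1_diffP; exact: (@ex_derive _ _ _ _ _ _ _ D).
Qed.

Lemma differentiable_inv_length y : sphere y ->
  differentiable (fun z : 'rV[R]_m => (Num.sqrt (dotv z z))^-1) y.
Proof.
move=> y1.
have dN : differentiable (fun z : 'rV[R]_m => dotv z z) y.
  by apply: differentiable_dotv.
apply: (differentiable_comp (g := fun r => (Num.sqrt r)^-1) dN).
by rewrite y1; exact: differentiable_inv_sqrt1.
Qed.

Lemma differentiable_normalize y : sphere y -> differentiable (@normalize R m) y.
Proof.
move=> y1; apply: differentiable_row => j.
rewrite (_ : (fun z => _) =
  (fun z : 'rV[R]_m => (Num.sqrt (dotv z z))^-1) * (fun z : 'rV[R]_m => z 0 j)).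
  apply: differentiableM; first exact: differentiable_inv_length.
  exact: differentiable_coord.
by apply/funext => z; rewrite /normalize mxE.
Qed.

(** The length is stationary at [y] in directions orthogonal to [y], so only the
    identity factor of [normalize] contributes. *)
Lemma derive_normalize y v : sphere y -> dotv v y = 0 ->
  'D_v (@normalize R m) y = v.
Proof.
move=> y1 vy; apply/rowP => j.
rewrite -derive_coord; last exact: differentiable_normalize.
have dN : differentiable (fun z : 'rV[R]_m => dotv z z) y.
  by apply: differentiable_dotv.
have D0 : 'D_v (fun z : 'rV[R]_m => (Num.sqrt (dotv z z))^-1) y = 0.
  rewrite (derive_comp (f := fun r => (Num.sqrt r)^-1)
    (g := fun z : 'rV[R]_m => dotv z z))//.
    rewrite (derive_dotv (f := id) (g := id))// derive_id (dotvC y) vy addr0.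
    exact: derive0.
  by rewrite y1; exact: differentiable_inv_sqrt1.
rewrite (_ : (fun z => _) =
  (fun z : 'rV[R]_m => (Num.sqrt (dotv z z))^-1) * (fun z : 'rV[R]_m => z 0 j));
  last first.
  by apply/funext => z; rewrite /normalize mxE.
have dj : differentiable (fun z : 'rV[R]_m => z 0 j) y by exact: differentiable_coord.
have dl := differentiable_inv_length y1.
rewrite deriveM; [|exact: diff_derivable..].
rewrite D0 scaler0 addr0 (derive_coord (g := id))//.
by rewrite derive_id /= y1 sqrtr1 invr1 scale1r.
Qed.

Lemma near_sphere (B : set 'rV[R]_m) y : open B -> B y -> sphere y ->
  \forall z \near y, B (normalize z) /\ sphere (normalize z).
Proof.
move=> B_open By y1.
have c1 := differentiable_continuous (differentiable_normalize y1).
have c2 : {for y, continuous (fun z : 'rV[R]_m => dotv z z)}.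
  by apply: differentiable_continuous; apply: differentiable_dotv.
have n1 : nbhs y [set z | B (normalize z)].
  by apply: c1; rewrite /= normalize_id//; exact: open_nbhs_nbhs.
have n2 : nbhs y [set z : 'rV[R]_m | dotv z z != 0].
  apply: (c2 [set r | r != 0]); rewrite y1.
  by apply: open_nbhs_nbhs; split; [exact: open_neq|exact: oner_neq0].
by apply: filterS2 n1 n2 => z Bz z0; split => //; exact: normalize_sphere.
Qed.

Lemma sphere_ext_near (W : normedModType R) (f G : 'rV[R]_m -> W)
    (B : set 'rV[R]_m) y :
  open B -> B y -> sphere y -> (forall z, B z -> sphere z -> G z = f z) ->
  exists A : set 'rV[R]_m, [/\ open A, A y &
    forall z, A z -> (G \o @normalize R m) z = (f \o @normalize R m) z].
Proof.
move=> B_open By y1 GF.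
exists (interior [set z | B (normalize z) /\ sphere (normalize z)]); split.
- exact: open_interior.
- exact: near_sphere.
- by move=> z /interior_subset[Bz z1]; exact: GF.
Qed.

(** Near [y] the map [normalize] takes values in the sphere and in [B], where [G]
    and [f] agree; so [f \o normalize] may be replaced by [G \o normalize], whose
    derivative is given by the chain rule and [derive_normalize]. *)
Lemma sphere_diff_ext (W : normedModType R) (f G : 'rV[R]_m -> W)
    (B : set 'rV[R]_m) y v :
  open B -> B y -> sphere y -> (forall z, B z -> sphere z -> G z = f z) ->
  differentiable G y -> dotv v y = 0 ->
  sphere_diff f y v = 'D_v G y.
Proof.
move=> B_open By y1 GF dG vy.
have [A [A_open Ay AE]] := sphere_ext_near B_open By y1 GF.
rewrite /sphere_diff -(derive_eq_on A_open v Ay AE) derive_comp.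
- by rewrite derive_normalize// normalize_id.
- exact: differentiable_normalize.
- by rewrite normalize_id.
Qed.

Lemma differentiable_on_sphere F y : smooth_on_sphere F -> sphere y ->
  differentiable (F \o @normalize R m) y.
Proof.
move=> F_smooth y1; have [B [G [B_open By sG GF]]] := F_smooth y y1.
have [A [A_open Ay AE]] := sphere_ext_near B_open By y1 GF.
apply: (differentiable_eq_on A_open Ay AE).
have /CkS[dG _] := sG 1.
apply: differentiable_comp; first exact: differentiable_normalize.
by rewrite normalize_id//; exact: dG.
Qed.

(** If [G] extends [F] near a point of the sphere, then the tangential part of the
    Euclidean gradient of [G], namely z |-> D_j G(z) - z_j sum_k z_k D_k G(z), is a
    smooth local extension of the j-th component of DF. *)
Lemma smooth_on_sphere_grad F j : smooth_on_sphere F ->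
  smooth_on_sphere (fun y => sphere_grad F y 0 j).
Proof.
move=> F_smooth y y1; have [B [G [B_open By sG GF]]] := F_smooth y y1.
exists B, (fun z => 'D_(delta_mx 0 j) G z +
  -1 * (z 0 j * \sum_k z 0 k * 'D_(delta_mx 0 k) G z)); split=> //.
  move=> k; have /CkS[_ DG] := sG k.+1.
  have Cz i : Ck k B (fun z : 'rV[R]_m => z 0 i).
    apply: (Ck_coord B_open (g := id)).
    case: k {DG} => [|k]; first by move=> a _; exact: cvg_id.
    split=> [a _ //|v]; rewrite (_ : 'D_v _ = fun=> v); first exact: Ck_cst.
    by apply/funext => a; exact: derive_id.
  apply: CkD => //; apply: CkM => //; first exact: Ck_cst.
  by apply: CkM => //; apply: Ck_sum => // i _; apply: CkM.
move=> z Bz z1; rewrite /sphere_grad mxE.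
have /CkS[dG _] := sG 1; have dGz := dG _ Bz.
rewrite (sphere_diff_ext B_open Bz z1 GF)//; last first.
  by rewrite /tangent_part dotvBl dotvZl z1 mulr1 subrr.
rewrite -(derive_basis z)// mulN1r /tangent_part dotv_deltal.
by rewrite !deriveE// [RHS]linearB [in RHS]linearZ.
Qed.

Lemma differentiable_sphere_grad F y : smooth_on_sphere F -> sphere y ->
  differentiable (sphere_grad F \o @normalize R m) y.
Proof.
move=> F_smooth y1; apply: differentiable_row => j.
exact: (differentiable_on_sphere (smooth_on_sphere_grad j F_smooth)).
Qed.

Lemma dotv_sphere_grad F y v : smooth_on_sphere F -> sphere y ->
  dotv (sphere_grad F y) v = sphere_diff F y (tangent_part y v).
Proof.
move=> F_smooth y1; have dF := differentiable_on_sphere F_smooth y1.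
rewrite /sphere_diff deriveE// /dotv.
have -> : tangent_part y v =
    \sum_j v 0 j *: tangent_part y (delta_mx 0 j).
  rewrite /tangent_part; under eq_bigr do rewrite scalerBr scalerA.
  rewrite sumrB -row_sum_delta -scaler_suml; congr (_ - _ *: _).
  by apply: eq_bigr => j _; rewrite dotv_deltal.
rewrite linear_sum; apply: eq_bigr => j _.
by rewrite linearZ /= mxE /sphere_diff deriveE// mulrC.
Qed.

Lemma dotv_sphere_grad_tangent F y v : smooth_on_sphere F -> sphere y ->
  dotv v y = 0 -> dotv (sphere_grad F y) v = sphere_diff F y v.
Proof.
move=> sF y1 vy; have tv : tangent_part y v = v.
  by rewrite /tangent_part vy scale0r subr0.
by have := dotv_sphere_grad v sF y1; rewrite tv.
Qed.

Lemma dotv_sphere_grad_normal F y : smooth_on_sphere F -> sphere y ->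
  dotv (sphere_grad F y) y = 0.
Proof.
move=> sF y1; rewrite dotv_sphere_grad// /tangent_part y1 scale1r subrr.
exact: derive0.
Qed.

Lemma A_sum F y (I : finType) (a : I -> R) (v : I -> 'rV[R]_m) :
  smooth_on_sphere F -> sphere y ->
  A_ F y (\sum_i a i *: v i) = \sum_i a i *: A_ F y (v i).
Proof.
move=> sF y1; have dF := differentiable_sphere_grad sF y1.
rewrite /A_ /sphere_hess /sphere_diff deriveE// linear_sum.
rewrite /tangent_part dotv_suml scaler_suml -sumrB scaler_sumr -big_split.
apply: eq_bigr => i _ /=; rewrite linearZ /= dotvZl deriveE//.
by rewrite !(scalerBr, scalerDr) !scalerA [F y * _]mulrC.
Qed.

End Sphere.

Section SphereChain.
Variables (R : realType) (m : nat) (V : normedModType R) (U : set V).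
Variable (nu : V -> 'rV[R]_m).
Hypothesis U_open : open U.
Hypothesis nu_sphere : forall a, U a -> sphere (nu a).

(** On the sphere [normalize] is the identity, so [f \o nu] coincides near [a] with
    [(f \o normalize) \o nu], a composition of maps between open sets. *)
Lemma derive_sphere_comp (W : normedModType R) (f : 'rV[R]_m -> W) a v :
  U a -> differentiable nu a -> differentiable (f \o @normalize R m) (nu a) ->
  'D_v (f \o nu) a = sphere_diff f (nu a) ('D_v nu a).
Proof.
move=> Ua dnu df; rewrite /sphere_diff -derive_comp//.
apply: (derive_eq_on U_open) => // z Uz.
by rewrite /= normalize_id//; exact: nu_sphere.
Qed.

(** Smoothness is local, and near the image of a point [f] has a smooth extension to
    an open set of the ambient space. *)
Lemma smooth_sphere_comp (f : 'rV[R]_m -> R) :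
  smooth_on_sphere f -> smooth_on U nu -> smooth_on U (f \o nu).
Proof.
move=> sf snu k; apply: Ck_local => // a Ua.
have [B [G [B_open Ba sG Gf]]] := sf _ (nu_sphere Ua).
pose A := interior (U `&` nu @^-1` B).
have A_open : open A by exact: open_interior.
have AU z : A z -> U z by move=> /interior_subset[].
exists A; split => //.
  have c_nu : {for a, continuous nu} := snu 0 a Ua.
  apply: filterI; first exact: open_nbhs_nbhs.
  by apply: c_nu; exact: open_nbhs_nbhs.
apply: (Ck_eq_on A_open (f := G \o nu)) => [z /interior_subset[Uz Bz]|].
  by rewrite /= Gf//; exact: nu_sphere.
apply: (Ck_comp A_open (B := B)) => [z /interior_subset[]//|//|].
exact: Ck_sub AU (snu k).
Qed.

End SphereChain.

(** * Differential calculus in a chart *)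

(** The same function as [pderiv], sealed so that comparing two derivatives never
    unfolds the limits that define them. *)
HB.lock Definition partial (R : realType) (n : nat) (M : smoothManifold R n)
    (c : chart R M n) (W : normedModType R) (i : 'I_n) (f : M -> W) (q : M) : W :=
  pderiv c i f q.

Lemma pderivE (R : realType) (n : nat) (M : smoothManifold R n)
  (c : chart R M n) (W : normedModType R) : @pderiv R n M c W = partial c (W := W).
Proof. by rewrite unlock. Qed.

Section ChartCalculus.
Variables (R : realType) (n : nat) (M : smoothManifold R n) (c : chart R M n).
Hypothesis c_atlas : atlas c.
Local Notation "'d_ i" := (partial c i) (at level 8, i at level 2).

Lemma partialE (W : normedModType R) i (f : M -> W) q :
  'd_i f q = 'D_(delta_mx 0 i) (f \o cinv c) (cmap c q).
Proof. by rewrite -pderivE. Qed.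

Definition csmooth (W : normedModType R) (f : M -> W) : Prop :=
  smooth_on (cimg c) (f \o cinv c).

Lemma cimg_open : open (cimg c).
Proof. by have [] := atlas_homeo c_atlas. Qed.

Lemma cmapK q : cdom c q -> cinv c (cmap c q) = q.
Proof. by have [_ _ K _ _] := atlas_homeo c_atlas => /K. Qed.

Lemma cimg_cmap q : cdom c q -> cimg c (cmap c q).
Proof. by exists q. Qed.

Lemma cdom_cinv u : cimg c u -> cdom c (cinv c u).
Proof. by move=> [q qc <-]; rewrite cmapK. Qed.

Lemma cinvK u : cimg c u -> cmap c (cinv c u) = u.
Proof. by move=> [q qc <-]; rewrite cmapK. Qed.

Lemma csmooth_differentiable (W : normedModType R) (f : M -> W) q :
  csmooth f -> cdom c q -> differentiable (f \o cinv c) (cmap c q).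
Proof. by move=> /(_ 1)/CkS[df _] qc; exact/df/cimg_cmap. Qed.

Lemma csmooth_eq (W : normedModType R) (f g : M -> W) :
  (forall q, cdom c q -> f q = g q) -> csmooth f -> csmooth g.
Proof.
move=> fg sf k; apply: (Ck_eq_on cimg_open _ (sf k)) => u Uu.
by rewrite /= fg//; exact: cdom_cinv.
Qed.

Lemma partial_eq (W : normedModType R) i (f g : M -> W) q :
  (forall q', cdom c q' -> f q' = g q') -> cdom c q -> 'd_i f q = 'd_i g q.
Proof.
move=> fg qc; rewrite !partialE; apply: (derive_eq_on cimg_open) => [|u Uu].
  exact: cimg_cmap.
by rewrite /= fg//; exact: cdom_cinv.
Qed.

Lemma csmooth_partial (W : normedModType R) i (f : M -> W) :
  csmooth f -> csmooth ('d_i f).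
Proof.
move=> sf k; have /CkS[_ /(_ (delta_mx 0 i)) Df] := sf k.+1.
by apply: (Ck_eq_on cimg_open _ Df) => u Uu; rewrite /= partialE cinvK.
Qed.

Lemma csmooth_cst (W : normedModType R) (w : W) : csmooth (fun=> w).
Proof. by move=> k; exact: Ck_cst. Qed.

Lemma csmoothD (W : normedModType R) (f g : M -> W) :
  csmooth f -> csmooth g -> csmooth (fun q => f q + g q).
Proof. by move=> sf sg k; exact: (CkD cimg_open (sf k) (sg k)). Qed.

Lemma csmooth_sum (W : normedModType R) I (r : seq I) (P : pred I)
    (f : I -> M -> W) :
  (forall i, P i -> csmooth (f i)) -> csmooth (fun q => \sum_(i <- r | P i) f i q).
Proof.
move=> sf k.
by apply: (@Ck_sum _ _ _ cimg_open _ _ _ _ _ (fun i => f i \o cinv c)) => i Pi;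
  exact: sf.
Qed.

Lemma csmoothM (f g : M -> R) :
  csmooth f -> csmooth g -> csmooth (fun q => f q * g q).
Proof. by move=> sf sg k; exact: (CkM cimg_open (sf k) (sg k)). Qed.

Lemma csmooth_prod I (r : seq I) (P : pred I) (f : I -> M -> R) :
  (forall i, P i -> csmooth (f i)) -> csmooth (fun q => \prod_(i <- r | P i) f i q).
Proof.
move=> sf k.
by apply: (@Ck_prod _ _ _ cimg_open _ _ _ _ (fun i => f i \o cinv c)) => i Pi;
  exact: sf.
Qed.

Lemma csmoothV (f : M -> R) :
  (forall q, cdom c q -> f q != 0) -> csmooth f -> csmooth (fun q => (f q)^-1).
Proof.
move=> f0 sf k; apply: (CkV cimg_open (f := f \o cinv c)) => // u Uu.
by apply: f0; exact: cdom_cinv.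
Qed.

Lemma csmooth_coord m (f : M -> 'rV[R]_m) j :
  csmooth f -> csmooth (fun q => f q 0 j).
Proof. by move=> sf k; exact: (Ck_coord cimg_open _ (sf k)). Qed.

Lemma csmooth_row m (f : M -> 'rV[R]_m) :
  (forall j, csmooth (fun q => f q 0 j)) -> csmooth f.
Proof. by move=> sf k; apply: (Ck_row cimg_open) => j; exact: sf. Qed.

Lemma csmoothZ m (a : M -> R) (f : M -> 'rV[R]_m) :
  csmooth a -> csmooth f -> csmooth (fun q => a q *: f q).
Proof.
move=> sa sf; apply: csmooth_row => j.
apply: (csmooth_eq (f := fun q => a q * f q 0 j)) => [q _|]; first by rewrite mxE.
by apply: csmoothM => //; exact: csmooth_coord.
Qed.

Lemma csmooth_dotv m (f g : M -> 'rV[R]_m) :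
  csmooth f -> csmooth g -> csmooth (fun q => dotv (f q) (g q)).
Proof.
by move=> sf sg; apply: csmooth_sum => j _; apply: csmoothM; exact: csmooth_coord.
Qed.

Lemma csmooth_det m (A : M -> 'M[R]_m) :
  (forall i j, csmooth (fun q => A q i j)) -> csmooth (fun q => \det (A q)).
Proof.
move=> sA; apply: csmooth_sum => s _; apply: csmoothM; first exact: csmooth_cst.
by apply: csmooth_prod.
Qed.

(** Cramer's rule. *)
Lemma csmooth_invmx m (A : M -> 'M[R]_m) i j :
  (forall q, cdom c q -> A q \in unitmx) ->
  (forall i j, csmooth (fun q => A q i j)) -> csmooth (fun q => invmx (A q) i j).
Proof.
move=> uA sA; apply: (csmooth_eq (f := fun q => (\det (A q))^-1 * cofactor (A q) j i)).
  by move=> q qc; rewrite /invmx uA// !mxE.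
apply: csmoothM.
  apply: csmoothV; last exact: csmooth_det.
  by move=> q qc; have := uA q qc; rewrite unitmxE unitfE.
apply: csmoothM; first exact: csmooth_cst.
apply: csmooth_det => k l.
apply: (csmooth_eq (f := fun q => A q (lift j k) (lift i l))) => // q _.
by rewrite !mxE.
Qed.

Lemma partial_cst (W : normedModType R) i (w : W) q : 'd_i (fun=> w) q = 0.
Proof. by rewrite partialE; exact: derive_cst. Qed.

Lemma partialD (W : normedModType R) i (f g : M -> W) q :
  csmooth f -> csmooth g -> cdom c q ->
  'd_i (fun q' => f q' + g q') q = 'd_i f q + 'd_i g q.
Proof.
move=> sf sg qc; rewrite !partialE -deriveD//;
by apply: diff_derivable; exact: csmooth_differentiable.
Qed.

Lemma partialN (W : normedModType R) i (f : M -> W) q :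
  csmooth f -> cdom c q -> 'd_i (fun q' => - f q') q = - 'd_i f q.
Proof.
move=> sf qc; rewrite !partialE -deriveN//.
by apply: diff_derivable; exact: csmooth_differentiable.
Qed.

Lemma partial_sum (W : normedModType R) i m (f : 'I_m -> M -> W) q :
  (forall k, csmooth (f k)) -> cdom c q ->
  'd_i (fun q' => \sum_k f k q') q = \sum_k 'd_i (f k) q.
Proof.
move=> sf qc; rewrite partialE; under [RHS]eq_bigr do rewrite partialE.
rewrite -derive_sum; last first.
  by move=> k; apply: diff_derivable; exact: csmooth_differentiable.
by congr derive; apply/funext => u; rewrite fct_sumE.
Qed.

Lemma partialM i (f g : M -> R) q :
  csmooth f -> csmooth g -> cdom c q ->
  'd_i (fun q' => f q' * g q') q = 'd_i f q * g q + f q * 'd_i g q.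
Proof.
move=> sf sg qc; rewrite !partialE [LHS]deriveM; last 2 first.
- by apply: diff_derivable; exact: csmooth_differentiable.
- by apply: diff_derivable; exact: csmooth_differentiable.
have comm2 (p1 p2 p3 p4 : R) : p1 *: p2 + p3 *: p4 = p4 * p3 + p1 * p2.
  by rewrite addrC; congr (_ + _); exact: mulrC.
by rewrite /= cmapK//; exact: comm2.
Qed.

Lemma partial_coord i m (f : M -> 'rV[R]_m) j q : csmooth f -> cdom c q ->
  'd_i (fun q' => f q' 0 j) q = 'd_i f q 0 j.
Proof.
by move=> sf qc; rewrite !partialE -derive_coord//; exact: csmooth_differentiable.
Qed.

Lemma partialZ i m (a : M -> R) (f : M -> 'rV[R]_m) q :
  csmooth a -> csmooth f -> cdom c q ->
  'd_i (fun q' => a q' *: f q') q = 'd_i a q *: f q + a q *: 'd_i f q.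
Proof.
move=> sa sf qc; apply/rowP => j; rewrite -partial_coord//; last exact: csmoothZ.
rewrite (@partial_eq _ i _ (fun q' => a q' * f q' 0 j))//; last first.
  by move=> q' _; rewrite mxE.
rewrite partialM//; last exact: csmooth_coord.
by rewrite partial_coord// !mxE.
Qed.

Lemma partial_dotv i m (f g : M -> 'rV[R]_m) q :
  csmooth f -> csmooth g -> cdom c q ->
  'd_i (fun q' => dotv (f q') (g q')) q =
  dotv ('d_i f q) (g q) + dotv (f q) ('d_i g q).
Proof.
move=> sf sg qc; rewrite !partialE derive_dotv; last 2 first.
- exact: csmooth_differentiable.
- exact: csmooth_differentiable.
by rewrite /= cmapK.
Qed.

Lemma partial_comm_fun i j (f : M -> R) q : csmooth f -> cdom c q ->
  'd_i ('d_j f) q = 'd_j ('d_i f) q.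
Proof.
move=> sf qc; have Uq := cimg_cmap qc.
have E k l : 'd_k ('d_l f) q =
    'D_(delta_mx 0 k) ('D_(delta_mx 0 l) (f \o cinv c)) (cmap c q).
  rewrite partialE; apply: (derive_eq_on cimg_open) => // u Uu.
  by rewrite /= partialE cinvK.
rewrite E [RHS]E.
exact: (@derive_comm R _ (cimg c) (f \o cinv c) (cmap c q) (delta_mx 0 j)
  (delta_mx 0 i) cimg_open Uq sf).
Qed.

Lemma partial_comm i j m (f : M -> 'rV[R]_m) q : csmooth f -> cdom c q ->
  'd_i ('d_j f) q = 'd_j ('d_i f) q.
Proof.
move=> sf qc; apply/rowP => k.
have E i1 j1 : 'd_i1 ('d_j1 f) q 0 k = 'd_i1 ('d_j1 (fun q' => f q' 0 k)) q.
  rewrite -partial_coord//; last exact: csmooth_partial.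
  by apply: partial_eq => // q' qc'; rewrite partial_coord.
have C := partial_comm_fun i j (csmooth_coord k sf) qc.
exact: etrans (E i j) (etrans C (esym (E j i))).
Qed.

Lemma csmooth_sphere_comp m (f : 'rV[R]_m -> R) (nu : M -> 'rV[R]_m) :
  smooth_on_sphere f -> (forall q, sphere (nu q)) -> csmooth nu ->
  csmooth (f \o nu).
Proof.
move=> sf nu1 snu.
exact: (smooth_sphere_comp cimg_open (nu := nu \o cinv c) (fun u _ => nu1 _) sf snu).
Qed.

Lemma partial_sphere_comp m (W : normedModType R) (f : 'rV[R]_m -> W)
    (nu : M -> 'rV[R]_m) i q :
  (forall q, sphere (nu q)) -> csmooth nu -> cdom c q ->
  differentiable (f \o @normalize R m) (nu q) ->
  'd_i (f \o nu) q = sphere_diff f (nu q) ('d_i nu q).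
Proof.
move=> nu1 snu qc df; rewrite !partialE.
have := @derive_sphere_comp _ _ _ _ (nu \o cinv c) cimg_open (fun u _ => nu1 _)
  _ f (cmap c q) (delta_mx 0 i) (cimg_cmap qc) (csmooth_differentiable snu qc).
by rewrite /= cmapK// => /(_ df).
Qed.

End ChartCalculus.

(** * Moving frames and the divergence formula *)

Section Frame.
Variables (R : realType) (n : nat) (M : smoothManifold R n) (c : chart R M n).
Hypothesis c_atlas : atlas c.
Variables (x nu : M -> 'rV[R]_n.+1).
Hypothesis x_imm : immersion x.
Hypothesis nu_gauss : gauss_map x nu.

Local Notation "'d_ i" := (partial c i) (at level 8, i at level 2).

(** The dual frame E^i of the coordinate frame: raising an index with the inverse
    metric turns [tcoord] into an inner product ([tcoordE]). *)
Definition coframe (i : 'I_n) (q : M) : 'rV[R]_n.+1 :=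
  \sum_j inv_metric c x q i j *: 'd_j x q.

Lemma csmooth_x : csmooth c x.
Proof. by have [sx _] := x_imm; exact: sx. Qed.

Lemma csmooth_nu : csmooth c nu.
Proof. by have [snu _ _] := nu_gauss; exact: snu. Qed.

Lemma nu_sphere q : sphere (nu q).
Proof. by have [_ + _] := nu_gauss; apply. Qed.

Lemma dotv_frame_nu q i : cdom c q -> dotv ('d_i x q) (nu q) = 0.
Proof. by have [_ _ orth] := nu_gauss; rewrite -pderivE; exact: orth. Qed.

Lemma csmooth_frame i : csmooth c ('d_i x).
Proof. by apply: csmooth_partial => //; exact: csmooth_x. Qed.

Lemma dotvE m (u v : 'rV[R]_m) : dotv u v = (u *m v^T) 0 0.
Proof. by rewrite mxE; apply: eq_bigr => i _; rewrite mxE. Qed.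

Lemma metric_entry q i j : metric c x q i j = dotv ('d_i x q) ('d_j x q).
Proof. by rewrite mxE pderivE. Qed.

Lemma jacobian_entry q i k : Defs.jacobian c x q i k = 'd_i x q 0 k.
Proof. by rewrite mxE pderivE. Qed.

Lemma metricE q : metric c x q = Defs.jacobian c x q *m (Defs.jacobian c x q)^T.
Proof.
apply/matrixP => i j; rewrite metric_entry mxE; apply: eq_bigr => k _.
by rewrite jacobian_entry mxE jacobian_entry.
Qed.

Lemma metric_sym q : (metric c x q)^T = metric c x q.
Proof. by rewrite metricE trmx_mul trmxK. Qed.

(** The metric is the Gram matrix J J^T of the rows of the Jacobian J: if u J J^T = 0
    then |u J|^2 = 0, and u = 0 because J has independent rows. *)
Lemma metric_unit q : cdom c q -> metric c x q \in unitmx.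
Proof.
move=> qc; have [_ /(_ c q c_atlas qc) Jfree] := x_imm.
rewrite -row_free_unit -kermx_eq0; apply/eqP/row_matrixP => i.
rewrite row0; set u := row i _.
have ug : u *m metric c x q = 0.
  by apply/eqP; rewrite -sub_kermx; exact: row_sub.
have uJ : u *m Defs.jacobian c x q = 0.
  apply/eqP; have : dotv (u *m Defs.jacobian c x q) (u *m Defs.jacobian c x q) = 0.
    by rewrite dotvE trmx_mul mulmxA -(mulmxA u) -metricE ug mul0mx mxE.
  move=> /eqP; rewrite psumr_eq0; last by move=> k _; rewrite -expr2 sqr_ge0.
  move=> /allP H; apply/eqP/rowP => k; rewrite [RHS]mxE.
  have := H k; rewrite mem_index_enum => /(_ isT)/=.
  by rewrite mulf_eq0 orbb => /eqP.
by apply/eqP; rewrite -(mulmx_free_eq0 u Jfree) uJ.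
Qed.

Lemma inv_metric_sym q i j : inv_metric c x q i j = inv_metric c x q j i.
Proof.
by rewrite /inv_metric -[in LHS]metric_sym -trmx_inv mxE.
Qed.

Lemma csmooth_metric i j : csmooth c (fun q => metric c x q i j).
Proof.
apply: (csmooth_eq c_atlas (f := fun q => dotv ('d_i x q) ('d_j x q))) => [q _|].
  by rewrite metric_entry.
by apply: csmooth_dotv => //; exact: csmooth_frame.
Qed.

Lemma csmooth_inv_metric i j : csmooth c (fun q => inv_metric c x q i j).
Proof.
apply: csmooth_invmx => //; first exact: metric_unit.
by move=> k l; exact: csmooth_metric.
Qed.

Lemma csmooth_coframe i : csmooth c (coframe i).
Proof.
apply: csmooth_sum => // j _.
by apply: csmoothZ => //; [exact: csmooth_inv_metric|exact: csmooth_frame].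
Qed.

Lemma tcoordE q v i : tcoord c x q v i = dotv v (coframe i q).
Proof. by rewrite dotv_sumr; apply: eq_bigr => j _; rewrite dotvZr pderivE. Qed.

Lemma dotv_frame_coframe q i j : cdom c q ->
  dotv ('d_j x q) (coframe i q) = (i == j)%:R.
Proof.
move=> qc; have := mulVmx (metric_unit qc) => /matrixP/(_ i j).
rewrite [RHS]mxE => <-; rewrite mxE dotv_sumr; apply: eq_bigr => k _.
by rewrite dotvZr metric_entry dotvC.
Qed.

Lemma dotv_nu_coframe q i : cdom c q -> dotv (coframe i q) (nu q) = 0.
Proof.
move=> qc; rewrite dotv_suml big1// => j _.
by rewrite dotvZl dotv_frame_nu// mulr0.
Qed.

(** The coordinate frame together with [nu] is a basis of R^(n+1), of which the
    coframe together with [nu] is the dual basis.  In matrix form: the block matrix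
    [B] with rows [nu] and d_i x has right inverse [C], and a one-sided inverse of a
    square matrix is two-sided. *)
Lemma dotv_expand q (v w : 'rV[R]_n.+1) : cdom c q ->
  dotv v w = \sum_i dotv v (coframe i q) * dotv ('d_i x q) w
             + dotv v (nu q) * dotv (nu q) w.
Proof.
move=> qc; pose J := Defs.jacobian c x q; pose gi := invmx (metric c x q).
pose B : 'M[R]_(1 + n, n.+1) := col_mx (nu q) J.
pose C : 'M[R]_(n.+1, 1 + n) := row_mx (nu q)^T (J^T *m gi).
have Jnu : J *m (nu q)^T = 0.
  apply/matrixP => i j; rewrite ord1 [RHS]mxE -(dotv_frame_nu i qc) mxE.
  by apply: eq_bigr => k _; rewrite jacobian_entry mxE.
have BC : B *m C = 1%:M.
  rewrite mul_col_row Jnu !mulmxA -metricE mulmxV ?metric_unit//.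
  rewrite -[nu q *m J^T]trmxK trmx_mul trmxK Jnu trmx0 mul0mx.
  rewrite [nu q *m _]mx11_scalar -dotvE nu_sphere.
  by rewrite -scalar_mx_block.
have CB : C *m B = 1%:M := mulmx1C BC.
have rowE (u : 'rV[R]_n.+1) i : (J *m u^T) i 0 = dotv ('d_i x q) u.
  by rewrite mxE; apply: eq_bigr => l _; rewrite jacobian_entry mxE.
transitivity ((v *m (C *m B) *m w^T) 0 0); first by rewrite dotvE CB mulmx1.
rewrite mul_row_col mulmxDr mulmxDl mxE addrC; congr (_ + _).
  rewrite mulmxA -mulmxA mxE; apply: eq_bigr => i _; rewrite rowE; congr (_ * _).
  rewrite mulmxA mxE dotv_sumr; apply: eq_bigr => k _.
  rewrite dotvZr -/(inv_metric c x q) inv_metric_sym mulrC; congr (_ * _).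
  by rewrite mxE; apply: eq_bigr => l _; rewrite mxE jacobian_entry.
by rewrite mulmxA -mulmxA mxE big_ord1 -!dotvE.
Qed.

Lemma dotv_nu_partial q i : cdom c q -> dotv ('d_i nu q) (nu q) = 0.
Proof.
move=> qc; have snu := csmooth_nu.
have := partial_cst c i (1 : R) q.
rewrite -(partial_eq c_atlas i (f := fun q' => dotv (nu q') (nu q')))//; last first.
  by move=> q' _; exact: nu_sphere.
rewrite partial_dotv// [X in _ + X]dotvC -mulr2n => /eqP.
by rewrite mulrn_eq0 => /eqP.
Qed.

Lemma partial_frame_nu q i j : cdom c q ->
  dotv ('d_j x q) ('d_i nu q) = - dotv ('d_i ('d_j x) q) (nu q).
Proof.
move=> qc; have snu := csmooth_nu; have sE := csmooth_frame j.
have := partial_cst c i (0 : R) q.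
rewrite -(partial_eq c_atlas i
  (f := fun q' => dotv ('d_j x q') (nu q')))//; last first.
  by move=> q' qc'; exact: dotv_frame_nu.
by rewrite partial_dotv// addrC => /eqP; rewrite addr_eq0 => /eqP.
Qed.

(** Self-adjointness of the Weingarten operator: both sides are minus the normal
    component of a second derivative of [x], and second derivatives commute. *)
Lemma shape_sym q i j : cdom c q ->
  dotv ('d_j x q) ('d_i nu q) = dotv ('d_i x q) ('d_j nu q).
Proof.
by move=> qc; rewrite !partial_frame_nu// (partial_comm c_atlas i j csmooth_x qc).
Qed.

Lemma frame_partial_coframe q i j k : cdom c q ->
  dotv ('d_k x q) ('d_j (coframe i) q) = - dotv ('d_j ('d_k x) q) (coframe i q).
Proof.
move=> qc; have sE := csmooth_frame k; have sD := csmooth_coframe i.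
have := partial_cst c j ((i == k)%:R : R) q.
rewrite -(partial_eq c_atlas j
  (f := fun q' => dotv ('d_k x q') (coframe i q')))//; last first.
  by move=> q' qc'; exact: dotv_frame_coframe.
by rewrite partial_dotv// addrC => /eqP; rewrite addr_eq0 => /eqP.
Qed.

Lemma nu_partial_coframe q i j : cdom c q ->
  dotv (nu q) ('d_j (coframe i) q) = - dotv ('d_j nu q) (coframe i q).
Proof.
move=> qc; have snu := csmooth_nu; have sD := csmooth_coframe i.
have := partial_cst c j (0 : R) q.
rewrite -(partial_eq c_atlas j
  (f := fun q' => dotv (nu q') (coframe i q')))//; last first.
  by move=> q' qc'; rewrite dotvC; exact: dotv_nu_coframe.
by rewrite partial_dotv// addrC => /eqP; rewrite addr_eq0 => /eqP.
Qed.

(** Differentiating the relations <d_k x, E^i> = const and <nu, E^i> = 0 gives the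
    components of d_j E^i on the frame and on [nu]. *)
Lemma dotv_partial_coframe q i j v : cdom c q ->
  dotv v ('d_j (coframe i) q) =
  - (\sum_k dotv v (coframe k q) * dotv ('d_j ('d_k x) q) (coframe i q))
  - dotv v (nu q) * dotv ('d_j nu q) (coframe i q).
Proof.
move=> qc; rewrite (dotv_expand v _ qc) nu_partial_coframe// mulrN; congr (_ - _).
rewrite -sumrN; apply: eq_bigr => k _.
by rewrite frame_partial_coframe// mulrN.
Qed.

(** The Koszul formula: expanding the derivatives of g_ij = <d_i x, d_j x> and using
    the symmetry of second derivatives, four of the six terms cancel. *)
Lemma christoffelE q k i j : cdom c q ->
  christoffel c x k i j q = dotv ('d_i ('d_j x) q) (coframe k q).
Proof.
move=> qc; have sE := csmooth_frame.
have dg a b l : 'd_a (fun q' => metric c x q' b l) q =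
    dotv ('d_a ('d_b x) q) ('d_l x q) + dotv ('d_b x q) ('d_a ('d_l x) q).
  by rewrite -partial_dotv//; apply: partial_eq => // q' _; rewrite metric_entry.
rewrite /christoffel pderivE dotv_sumr mulr_sumr; apply: eq_bigr => l _.
rewrite dotvZr !dg.
rewrite (partial_comm c_atlas i l csmooth_x qc).
rewrite (partial_comm c_atlas j l csmooth_x qc).
rewrite (partial_comm c_atlas j i csmooth_x qc).
rewrite mulrCA; congr (_ * _).
rewrite (dotvC ('d_l ('d_i x) q)).
set a := dotv _ _; set b := dotv ('d_j x q) _; set d := dotv ('d_i x q) _.
by field.
Qed.

Lemma divergence_eq (X Y : M -> 'rV[R]_n.+1) q :
  (forall q', cdom c q' -> X q' = Y q') -> cdom c q ->
  divergence c x X q = divergence c x Y q.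
Proof.
move=> XY qc; rewrite /divergence; apply: eq_bigr => i _; rewrite XY//.
by congr (_ + _); rewrite pderivE; apply: partial_eq => // q' qc'; rewrite XY.
Qed.

(** The Christoffel term of the divergence cancels the contribution of the
    derivative of the coframe. *)
Lemma divergence_tangent (X : M -> 'rV[R]_n.+1) q :
  csmooth c X -> cdom c q -> dotv (X q) (nu q) = 0 ->
  divergence c x X q = \sum_i dotv ('d_i X q) (coframe i q).
Proof.
move=> sX qc Xnu; apply: eq_bigr => i _; rewrite pderivE.
rewrite (_ : (fun q' => _) = fun q' => dotv (X q') (coframe i q')); last first.
  by apply/funext => q'; rewrite tcoordE.
rewrite partial_dotv//; last exact: csmooth_coframe.
rewrite dotv_partial_coframe// Xnu mul0r subr0 -addrA addrC -[RHS]add0r; congr (_ + _).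
rewrite addrC; apply/eqP; rewrite subr_eq0; apply/eqP.
by apply: eq_bigr => j _; rewrite tcoordE christoffelE// mulrC.
Qed.

Lemma gradientE f q : gradient c x f q = \sum_i 'd_i f q *: coframe i q.
Proof.
rewrite /gradient !pderivE; under eq_bigr do rewrite scaler_suml.
rewrite exchange_big /=; apply: eq_bigr => j _; rewrite scaler_sumr.
by apply: eq_bigr => i _; rewrite scalerA inv_metric_sym mulrC.
Qed.

Lemma dotv_gradient_nu f q : cdom c q -> dotv (gradient c x f q) (nu q) = 0.
Proof.
move=> qc; rewrite gradientE dotv_suml big1// => i _.
by rewrite dotvZl dotv_nu_coframe// mulr0.
Qed.

(** A function whose differential is <v, d nu> has gradient d nu (v^T), where v^T is
    the tangential part of [v]: this is the self-adjointness of d nu. *)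
Lemma gradient_shape f (v : 'rV[R]_n.+1) q : cdom c q ->
  (forall i, 'd_i f q = dotv v ('d_i nu q)) ->
  gradient c x f q = \sum_i dotv v (coframe i q) *: 'd_i nu q.
Proof.
move=> qc df; apply/rowP => k; rewrite -!dotv_deltal; set e := delta_mx 0 k.
have nuE w j : dotv w ('d_j nu q) =
    \sum_i dotv w (coframe i q) * dotv ('d_i x q) ('d_j nu q).
  by rewrite (dotv_expand _ _ qc) [dotv (nu q) _]dotvC dotv_nu_partial// mulr0 addr0.
rewrite gradientE !dotv_sumr.
under eq_bigr do rewrite dotvZr df nuE mulr_suml.
rewrite exchange_big /=; apply: eq_bigr => i _.
rewrite dotvZr (nuE e) mulr_sumr; apply: eq_bigr => j _.
by rewrite shape_sym// -mulrA; congr (_ * _); rewrite mulrC.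
Qed.

Variable (xi : M -> 'rV[R]_n.+1).
Hypothesis xi_smooth : csmooth c xi.
Hypothesis xi_tangent : forall q i, cdom c q -> dotv ('d_i xi q) (nu q) = 0.

(** The image of the tangential part of [C] under the differential of [xi]. *)
Definition transport (C : M -> 'rV[R]_n.+1) (q : M) : 'rV[R]_n.+1 :=
  \sum_i dotv (C q) (coframe i q) *: 'd_i xi q.

(** The product rule splits each <d_i W_C, E^i> into a term with d_i C, a term with
    d_i E^j and a term with d_j d_i xi.  The same second derivatives of [xi] occur in
    the gradient of H, together with another term in the derivatives of the coframe;
    by [dotv_partial_coframe] the tangential parts of the two coframe terms are
    equal up to renaming indices and the symmetry of d_k d_i x, so that only the
    normal part of the first one survives. *)
Lemma divergence_transport (C : M -> 'rV[R]_n.+1) (H : M -> R) q :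
  csmooth c C -> cdom c q ->
  (forall q', cdom c q' -> H q' = - \sum_i dotv ('d_i xi q') (coframe i q')) ->
  divergence c x (transport C) q =
  - dotv (C q) (gradient c x H q)
  - (\sum_i \sum_j dotv ('d_i nu q) (coframe j q) * dotv ('d_j xi q) (coframe i q))
    * dotv (C q) (nu q)
  + \sum_i \sum_j dotv ('d_i C q) (coframe j q) * dotv ('d_j xi q) (coframe i q).
Proof.
move=> sC qc HE; have sD := csmooth_coframe.
have sxi i : csmooth c ('d_i xi) by exact: csmooth_partial.
have sCD i : csmooth c (fun q' => dotv (C q') (coframe i q')) by exact: csmooth_dotv.
have sW : csmooth c (transport C).
  by apply: csmooth_sum => // i _; exact: csmoothZ.
rewrite divergence_tangent//; last first.
  by rewrite dotv_suml big1// => i _; rewrite dotvZl xi_tangent// mulr0.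
have dH i : 'd_i H q = - \sum_j (dotv ('d_i ('d_j xi) q) (coframe j q)
    + dotv ('d_j xi q) ('d_i (coframe j) q)).
  rewrite (partial_eq c_atlas i HE qc) partialN//; last first.
    by apply: csmooth_sum => // j _; exact: csmooth_dotv.
  rewrite partial_sum//; last by move=> j; exact: csmooth_dotv.
  by congr (- _); apply: eq_bigr => j _; rewrite partial_dotv.
have dW i : dotv ('d_i (transport C) q) (coframe i q) =
    \sum_j dotv ('d_i C q) (coframe j q) * dotv ('d_j xi q) (coframe i q)
  + \sum_j dotv (C q) ('d_i (coframe j) q) * dotv ('d_j xi q) (coframe i q)
  + \sum_j dotv (C q) (coframe j q) * dotv ('d_j ('d_i xi) q) (coframe i q).
  rewrite /transport partial_sum//; last by move=> j; exact: csmoothZ.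
  rewrite dotv_suml -!big_split; apply: eq_bigr => j _ /=.
  rewrite partialZ// partial_dotv// dotvDl !dotvZl mulrDl.
  by rewrite (partial_comm c_atlas i j xi_smooth qc).
under eq_bigr do rewrite dW.
rewrite !big_split /=.
(* The normal part of the derivatives of the coframe does not contribute here,
   since the derivatives of xi are tangent. *)
have gradH : - dotv (C q) (gradient c x H q) =
    \sum_i \sum_j dotv (C q) (coframe j q) * dotv ('d_j ('d_i xi) q) (coframe i q)
  - \sum_i \sum_j \sum_k dotv (C q) (coframe j q) *
     (dotv ('d_i xi q) (coframe k q) * dotv ('d_j ('d_k x) q) (coframe i q)).
  rewrite gradientE dotv_sumr -sumrN.
  under eq_bigr do rewrite dotvZr dH mulNr opprK mulr_suml.
  rewrite exchange_big /= -sumrB; apply: eq_bigr => i _.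
  rewrite -sumrB; apply: eq_bigr => j _.
  rewrite dotv_partial_coframe// xi_tangent// mul0r subr0 -mulr_sumr -mulrBr.
  by rewrite mulrC.
rewrite gradH.
have -> : \sum_i \sum_j
      dotv (C q) ('d_i (coframe j) q) * dotv ('d_j xi q) (coframe i q) =
    - (\sum_i \sum_j \sum_k dotv (C q) (coframe j q) *
     (dotv ('d_i xi q) (coframe k q) * dotv ('d_j ('d_k x) q) (coframe i q)))
    - (\sum_i \sum_j dotv ('d_i nu q) (coframe j q) * dotv ('d_j xi q) (coframe i q))
      * dotv (C q) (nu q).
  have -> : \sum_i \sum_j \sum_k dotv (C q) (coframe j q) *
     (dotv ('d_i xi q) (coframe k q) * dotv ('d_j ('d_k x) q) (coframe i q)) =
     \sum_i \sum_j \sum_k dotv (C q) (coframe k q) *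
     (dotv ('d_j xi q) (coframe i q) * dotv ('d_i ('d_k x) q) (coframe j q)).
    (* The cyclic renaming (i, j, k) -> (j, k, i), up to the symmetry of d_k d_i x. *)
    rewrite exchange_big /=; under eq_bigr do rewrite exchange_big /=.
    rewrite exchange_big /=; apply: eq_bigr => i _.
    rewrite exchange_big /=; apply: eq_bigr => j _; apply: eq_bigr => k _.
    by rewrite (partial_comm c_atlas k i csmooth_x qc).
  rewrite mulr_suml -opprD -big_split /= -sumrN; apply: eq_bigr => i _.
  rewrite mulr_suml -big_split /= -sumrN; apply: eq_bigr => j _.
  rewrite dotv_partial_coframe// -opprD mulNr; congr (- _).
  rewrite mulrDl mulr_suml; congr (_ + _); last by ring.
  by apply: eq_bigr => k _; ring.
by ring.
Qed.

End Frame.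

(** * The Cahn-Hoffman map and the anisotropic operators *)

Section Hypersurface.
Variables (R : realType) (n : nat) (M : smoothManifold R n) (c : chart R M n).
Hypothesis c_atlas : atlas c.
Variables (x nu : M -> 'rV[R]_n.+1).
Hypothesis x_imm : immersion x.
Hypothesis nu_gauss : gauss_map x nu.
Variable (F : 'rV[R]_n.+1 -> R).
Hypothesis F_smooth : smooth_on_sphere F.

Local Notation "'d_ i" := (partial c i) (at level 8, i at level 2).
Local Notation coframe := (coframe c x).

(** The Euclidean gradient at [nu q] of the 1-homogeneous extension of [F]. *)
Definition cahn_hoffman (q : M) : 'rV[R]_n.+1 :=
  sphere_grad F (nu q) + F (nu q) *: nu q.
Local Notation xi := cahn_hoffman.

Let snu : csmooth c nu := csmooth_nu c_atlas nu_gauss.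
Let nu1 := nu_sphere nu_gauss.

Lemma csmooth_support : csmooth c (F \o nu).
Proof. exact: csmooth_sphere_comp. Qed.

Lemma csmooth_sphere_grad : csmooth c (sphere_grad F \o nu).
Proof.
apply: csmooth_row => // j.
apply: (csmooth_sphere_comp c_atlas (f := fun y => sphere_grad F y 0 j)) => //.
exact: smooth_on_sphere_grad.
Qed.

Lemma csmooth_xi : csmooth c xi.
Proof.
apply: csmoothD => //; first exact: csmooth_sphere_grad.
by apply: csmoothZ => //; exact: csmooth_support.
Qed.

Lemma partial_support q i : cdom c q ->
  'd_i (F \o nu) q = dotv (sphere_grad F (nu q)) ('d_i nu q).
Proof.
move=> qc; rewrite partial_sphere_comp//; last exact: differentiable_on_sphere.
by rewrite dotv_sphere_grad_tangent// (dotv_nu_partial c_atlas nu_gauss).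
Qed.

(** The normal component of d(DF o nu) is - <DF, nu_i>, by differentiation of
    <DF(nu), nu> = 0; it cancels the term d_i(F o nu) nu, and what remains is
    (D^2 F + F) nu_i. *)
Lemma partial_xi q i : cdom c q -> 'd_i xi q = A_ F (nu q) ('d_i nu q).
Proof.
move=> qc; have sF := csmooth_support; have sG := csmooth_sphere_grad.
have sZ : csmooth c (fun q' => (F \o nu) q' *: nu q') by exact: csmoothZ.
rewrite (partialD i sG sZ qc) (partialZ c_atlas i sF snu qc).
rewrite partial_support// /A_ /sphere_hess.
rewrite -(partial_sphere_comp c_atlas i nu1 snu qc); last first.
  exact: differentiable_sphere_grad.
have E : dotv ('d_i (sphere_grad F \o nu) q) (nu q) =
    - dotv (sphere_grad F (nu q)) ('d_i nu q).
  have := partial_cst c i (0 : R) q.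
  rewrite -(partial_eq c_atlas i
    (f := fun q' => dotv ((sphere_grad F \o nu) q') (nu q')))//; last first.
    by move=> q' _; exact: dotv_sphere_grad_normal.
  by rewrite partial_dotv// => /eqP; rewrite addr_eq0 => /eqP.
by rewrite /tangent_part E scaleNr opprK addrA.
Qed.

Lemma xi_tangent q i : cdom c q -> dotv ('d_i xi q) (nu q) = 0.
Proof.
move=> qc; rewrite partial_xi// /A_ /sphere_hess /tangent_part.
rewrite dotvDl dotvBl !dotvZl nu1 mulr1 subrr add0r.
by rewrite (dotv_nu_partial c_atlas nu_gauss)// mulr0.
Qed.

Lemma dotv_xi_nu q : dotv (xi q) (nu q) = F (nu q).
Proof.
by rewrite dotvDl dotv_sphere_grad_normal// dotvZl nu1 mulr1 add0r.
Qed.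

Lemma dotv_xi_partial_nu q i : cdom c q ->
  dotv (xi q) ('d_i nu q) = 'd_i (F \o nu) q.
Proof.
move=> qc; rewrite dotvDl dotvZl [dotv (nu q) _]dotvC.
by rewrite (dotv_nu_partial c_atlas nu_gauss)// mulr0 addr0 partial_support.
Qed.

Lemma A_shape q (a : 'I_n -> R) : cdom c q ->
  A_ F (nu q) (\sum_i a i *: 'd_i nu q) = \sum_i a i *: 'd_i xi q.
Proof.
by move=> qc; rewrite A_sum//; apply: eq_bigr => i _; rewrite partial_xi.
Qed.

Lemma weingartenE q v :
  weingarten c x nu q v = \sum_i (- dotv v (coframe i q)) *: 'd_i nu q.
Proof.
rewrite /weingarten -sumrN pderivE; apply: eq_bigr => i _.
by rewrite tcoordE// scaleNr.
Qed.

Lemma aweingartenE q v : cdom c q ->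
  aweingarten c x F nu q v = \sum_i (- dotv v (coframe i q)) *: 'd_i xi q.
Proof. by move=> qc; rewrite /aweingarten weingartenE A_shape. Qed.

Lemma frame_sum (V : lmodType R) q i (w : 'I_n -> V) : cdom c q ->
  \sum_j (- dotv ('d_i x q) (coframe j q)) *: w j = - w i.
Proof.
move=> qc; rewrite (bigD1 i)//= (dotv_frame_coframe c_atlas x_imm)// eqxx scaleN1r.
rewrite big1 ?addr0// => j ji.
by rewrite (dotv_frame_coframe c_atlas x_imm)// (negPf ji) oppr0 scale0r.
Qed.

Lemma amean_curvE q : cdom c q ->
  amean_curv c x F nu q = - \sum_i dotv ('d_i xi q) (coframe i q).
Proof.
move=> qc; rewrite /amean_curv /ttrace -sumrN pderivE; apply: eq_bigr => i _.
by rewrite tcoordE// aweingartenE// frame_sum// dotvNl.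
Qed.

Lemma tr_SF2E q : cdom c q -> tr_SF2 c x F nu q =
  \sum_i \sum_j dotv ('d_i xi q) (coframe j q) * dotv ('d_j xi q) (coframe i q).
Proof.
move=> qc; rewrite /tr_SF2 /ttrace pderivE; apply: eq_bigr => i _.
rewrite tcoordE//= [aweingarten _ _ _ _ _ ('d_i x q)]aweingartenE// frame_sum//.
rewrite aweingartenE// dotv_suml; apply: eq_bigr => j _.
by rewrite dotvZl dotvNl opprK.
Qed.

Lemma tr_AS2E q : cdom c q -> tr_AS2 c x F nu q =
  \sum_i \sum_j dotv ('d_i nu q) (coframe j q) * dotv ('d_j xi q) (coframe i q).
Proof.
move=> qc; rewrite /tr_AS2 /ttrace pderivE; apply: eq_bigr => i _.
rewrite tcoordE//= [weingarten _ _ _ _ ('d_i x q)]weingartenE frame_sum//.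
rewrite weingartenE A_shape// dotv_suml; apply: eq_bigr => j _.
by rewrite dotvZl dotvNl opprK.
Qed.

(** By [gradient_shape] the gradient of [f] is a combination of the nu_j, which A_F
    maps to the same combination of the xi_j. *)
Lemma alaplacian_transport (f : M -> R) (C : M -> 'rV[R]_n.+1) q :
  csmooth c C -> cdom c q ->
  (forall q' i, cdom c q' -> 'd_i f q' = dotv (C q') ('d_i nu q')) ->
  alaplacian c x F nu f q =
  - dotv (C q) (gradient c x (amean_curv c x F nu) q)
  - tr_AS2 c x F nu q * dotv (C q) (nu q)
  + \sum_i \sum_j dotv ('d_i C q) (coframe j q) * dotv ('d_j xi q) (coframe i q).
Proof.
move=> sC qc df; rewrite tr_AS2E//.
rewrite -(divergence_transport c_atlas x_imm nu_gauss csmooth_xi xi_tangent sC qc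
  amean_curvE).
apply: divergence_eq => // q' qc'.
rewrite (gradient_shape c_atlas x_imm nu_gauss qc' (fun i => df q' i qc')).
by rewrite A_shape.
Qed.

End Hypersurface.

(** * The three identities *)

Theorem proposition2p1 (R : realType) (n : nat)
    (F : 'rV[R]_n.+1 -> R)
    (F_smooth : smooth_on_sphere F)
    (F_pos : forall y, sphere y -> 0 < F y)
    (AF_pos : A_posdef F)
    (Sigma : smoothManifold R n)
    (x nu : Sigma -> 'rV[R]_n.+1)
    (x_imm : immersion x)
    (nu_gauss : gauss_map x nu)
    (c : chart R Sigma n) (c_atlas : atlas c)
    (q : Sigma) (q_c : cdom c q) :
  let p := fun q' => dotv (x q') (nu q') in
  let HF := amean_curv c x F nu in
  let trAS2 := tr_AS2 c x F nu in
  [/\ alaplacian c x F nu (F \o nu) q + trAS2 q * F (nu q)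
        + dotv (gradient c x HF q) (sphere_grad F (nu q))
      = tr_SF2 c x F nu q,
      alaplacian_vec c x F nu nu q + trAS2 q *: nu q + gradient c x HF q = 0
    & alaplacian c x F nu p q + trAS2 q * p q + HF q
        + dotv (x q) (gradient c x HF q)
      = 0].
Proof.
move=> p HF trAS2.
have sx := csmooth_x c_atlas x_imm; have snu := csmooth_nu c_atlas nu_gauss.
have nu1 := nu_sphere nu_gauss.
have gn := dotv_gradient_nu c_atlas nu_gauss HF q_c.
split.
- rewrite (alaplacian_transport c_atlas x_imm nu_gauss F_smooth
    (C := cahn_hoffman nu F))//; first last.
  + by move=> q' i q'c; rewrite (dotv_xi_partial_nu c_atlas nu_gauss).
  + exact: (csmooth_xi c_atlas nu_gauss).
  rewrite (dotv_xi_nu nu_gauss)// (tr_SF2E c_atlas x_imm nu_gauss)//.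
  rewrite /cahn_hoffman dotvDl dotvZl.
  rewrite [dotv (nu q) _]dotvC gn mulr0 addr0 [dotv (gradient _ _ _ _) _]dotvC.
  by rewrite -/HF -/trAS2; ring.
- apply/rowP => j; rewrite !mxE.
  rewrite (alaplacian_transport c_atlas x_imm nu_gauss F_smooth
    (C := fun=> delta_mx 0 j))//; first last.
  + by move=> q' i q'c; rewrite partial_coord// dotv_deltal.
  + exact: csmooth_cst.
  rewrite !dotv_deltal -/HF -/trAS2 big1 ?addr0; first by ring.
  move=> i _; rewrite big1// => k _.
  by rewrite partial_cst dotv0l mul0r.
- rewrite (alaplacian_transport c_atlas x_imm nu_gauss F_smooth (C := x))//; last first.
    move=> q' i q'c; rewrite partial_dotv//.
    by rewrite (dotv_frame_nu c_atlas nu_gauss)// add0r.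
  have -> : \sum_i \sum_j dotv (partial c i x q) (coframe c x j q)
      * dotv (partial c j (cahn_hoffman nu F) q) (coframe c x i q) = - HF q.
    rewrite /HF (amean_curvE c_atlas x_imm nu_gauss)// opprK; apply: eq_bigr => i _.
    rewrite (bigD1 i)//= (dotv_frame_coframe c_atlas x_imm)// eqxx mul1r.
    rewrite big1 ?addr0// => j ji.
    by rewrite (dotv_frame_coframe c_atlas x_imm)// (negPf ji) mul0r.
  by rewrite -/HF -/trAS2 -/(p q); ring.
Qed.
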